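(* Let $\Delta$ be a simplicial complex on the vertex set $[n]$ and let $\mathfrak{I}\subseteq\mathbb{R}_\Delta$ be a cone of cooperative games containing, for every vertex $i$, the carrier games $v_T$ (for non-empty $T\in\operatorname{Lk}_\Delta i$) and $\hat v_T$ (for all $T\in\operatorname{Lk}_\Delta i$). Assume that if $v\in\mathfrak{I}$, then the permuted game $\pi\cdot v$ is also in $\mathfrak{I}$ for every $\pi\in\operatorname{Symm}(\Delta)$. Let $\phi=(\phi_1,\dots,\phi_n)$ be a group value on $\mathfrak I$ such that for each $i\in[n]$ and each $v\in\mathfrak{I}$ we can write $$\phi_i(v)=\sum_{T\in \operatorname{Lk}_\Delta i}p_T^i\left(v(T\cup i)-v(T)\right)$$ with real numbers $p_T^i$. If $\pi(\Delta)\subseteq\operatorname{Symm}(\Delta)$ and if $\phi$ satisfies the symmetry axiom, then there are real constants $p_t$, $t=1,\dots,\operatorname{rank}\Delta-1$, such that $p_T^i=p_{|T|}$ for all players $i$ and all non-empty $T\in\operatorname{Lk}_\Delta i$.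
   Context: $[n]=\{1,\dots,n\}$. A simplicial complex $\Delta$ on $[n]$ is a (finite, non-empty) family of subsets of $[n]$ closed under taking subsets; $[n]$ is its set of vertices (players). Its rank is the maximal cardinality of its elements. We write $T\cup i$ for $T\cup\{i\}$. Link of $i$: $\operatorname{Lk}_\Delta i=\{T\in\Delta : i\notin T,\ T\cup i\in\Delta\}$. A cooperative game on $\Delta$ is a function $v:\Delta\to\mathbb{R}$ with $v(\emptyset)=0$; $\mathbb{R}_\Delta$ is the real vector space of all such functions. A cone $\mathfrak{I}\subseteq\mathbb{R}_\Delta$ is a subset closed under multiplication by positive scalars. An individual value for player $i$ is a function $\phi_i:\mathfrak{I}\to\mathbb{R}$; a group value is $\phi=(\phi_1,\dots,\phi_n)$, one individual value for each player. Carrier games: for $\emptyset\neq T\in\Delta$ and $S\in\Delta$, $v_T(S)=1$ if $T\subseteq S$ and $0$ otherwise; for $T\in\Delta$ (including $T=\emptyset$), $\hat v_T(S)=1$ if $T\subsetneq S$ and $0$ otherwise. $\operatorname{Symm}(\Delta)$ is the subgroup of the symmetric group $S_n$ of permutations $\pi$ such that $T\in\Delta$ implies $\pi T\in\Delta$. For $\pi\in\operatorname{Symm}(\Delta)$, $(\pi\cdot v)(T)=v(\pi T)$. Symmetry axiom: $\phi_i(v)=\phi_{\pi i}(\pi\cdot v)$ for every $\pi\in\operatorname{Symm}(\Delta)$, every $i\in[n]$ and every $v\in\mathfrak I$. For $L,T\in\operatorname{Lk}_\Delta i$ with $|L|=|T|$, $\pi_{L,T}^i$ denotes the permutation of $[n]$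 that switches $L$ and $T$ (so $\pi_{L,T}^i(L)=T$ and $\pi_{L,T}^i(T)=L$) and fixes $i$ (a fixed choice of such a permutation); $\pi_{i,j}$ denotes the transposition $(i,j)$. $\pi(\Delta)$ is the subgroup of $S_n$ generated by all $\pi_{L,T}^i$ (all $i$, all $L,T\in\operatorname{Lk}_\Delta i$ with $|L|=|T|$) and by all transpositions $\pi_{i,j}$ with $\operatorname{Lk}_\Delta i\cap\operatorname{Lk}_\Delta j\neq\emptyset$. *)

(* Defs.v *)
From HB Require Import structures.
From mathcomp Require Import all_boot all_order all_algebra all_fingroup.
From mathcomp Require Import all_classical all_reals.

Set Implicit Arguments.
Unset Strict Implicit.
Unset Printing Implicit Defensive.

Import Order.TTheory GRing.Theory Num.Theory.
Local Open Scope ring_scope.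

(* The players 1, ..., n are the elements of 'I_n. *)
Record simplicial_complex (n : nat) := SimplicialComplex {
  faces :> {set {set 'I_n}};
  faces_neq0 : faces != finset.set0;
  faces_sub : forall S T : {set 'I_n}, S \in faces -> T \subset S -> T \in faces
}.

Lemma set0_face (n : nat) (D : simplicial_complex n) : finset.set0 \in faces D.
Proof.
have /set0Pn[S SD] := faces_neq0 D.
exact: faces_sub SD (finset.sub0set S).
Qed.

Notation face D := {S : {set 'I_(_)} | S \in faces D}.

Definition face0 (n : nat) (D : simplicial_complex n) : face D :=
  exist _ finset.set0 (set0_face D).

Definition rank (n : nat) (D : simplicial_complex n) : nat :=
  (\max_(S in faces D) #|S|)%N.

Definition link (n : nat) (D : simplicial_complex n) (i : 'I_n) :
    {set {set 'I_n}} :=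
  [set T : {set 'I_n} | [&& T \in faces D, i \notin T & i |: T \in faces D]]%SET.

Section Games.
Variables (R : realType) (n : nat) (D : simplicial_complex n).

(* R^o is R seen as a module over itself, so that functions into it form a
   vector space over R. *)
Definition is_game : {pred {ffun face D -> R^o}} :=
  [pred v : {ffun face D -> R^o} | v (face0 D) == 0].

Lemma is_game_submod_closed : submod_closed is_game.
Proof.
split=> [|a u v]; rewrite !inE !ffunE // => /eqP -> /eqP ->.
by rewrite scaler0 addr0.
Qed.
HB.instance Definition _ := GRing.isSubmodClosed.Build R {ffun face D -> R^o}
  is_game is_game_submod_closed.

(* The vector space of cooperative games on D. *)
Record game := Game {
  game_fun : {ffun face D -> R^o};
  game_funP : game_fun \in is_game
}.
HB.instance Definition _ := [isSub for game_fun].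
HB.instance Definition _ := [Choice of game by <:].
HB.instance Definition _ := [SubChoice_isSubLmodule of game by <:].

(* The value v(S) of the game v on the coalition S; sets that are not faces
   get the dummy value 0. *)
Definition game_eval (v : game) (S : {set 'I_n}) : R :=
  if insub S is Some s then game_fun v s else 0.

Lemma game_eval0 (v : game) : game_eval v finset.set0 = 0.
Proof.
rewrite /game_eval; case: insubP => // s _ s0.
have -> : s = face0 D by apply: val_inj.
by have := game_funP v; rewrite inE => /eqP.
Qed.

Lemma carrier_subproof (T : {set 'I_n}) : T != finset.set0 ->
  [ffun S : face D => (T \subset val S)%:R : R^o] \in is_game.
Proof. by rewrite inE ffunE /= finset.subset0 => /negbTE ->. Qed.

Definition carrier (T : {set 'I_n}) (T0 : T != finset.set0) : game :=
  Game (carrier_subproof T0).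

Lemma carrier_hat_subproof (T : {set 'I_n}) :
  [ffun S : face D => (T \proper val S)%:R : R^o] \in is_game.
Proof. by rewrite inE ffunE /= properE finset.sub0set andbF. Qed.

Definition carrier_hat (T : {set 'I_n}) : game := Game (carrier_hat_subproof T).

Lemma perm_game_subproof (s : 'S_n) (v : game) :
  [ffun S : face D => game_eval v (s @: val S)%SET : R^o] \in is_game.
Proof. by rewrite inE ffunE /= imset0 game_eval0. Qed.

(* (s . v)(T) = v(s T); meant for s in Symm D. *)
Definition perm_game (s : 'S_n) (v : game) : game :=
  Game (perm_game_subproof s v).

Definition is_cone (I : set game) : Prop :=
  forall (c : R) (v : game), 0 < c -> I v -> I (c *: v).

End Games.

Coercion game_eval : game >-> Funclass.

Definition Symm (n : nat) (D : simplicial_complex n) : {set 'S_n} :=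
  [set s : 'S_n | [forall T in faces D, (s @: (T : {set 'I_n}))%SET \in faces D]]%SET.

Definition symmetric_on (R : realType) (n : nat) (D : simplicial_complex n)
    (I : set (game R D)) (phi : 'I_n -> game R D -> R) : Prop :=
  forall (s : 'S_n) (i : 'I_n) (v : game R D), s \in Symm D -> I v ->
    phi i v = phi (s i) (perm_game s v).

(* sw is a choice of the permutations switching L and T and fixing i. *)
Definition switching (n : nat) (D : simplicial_complex n)
    (sw : 'I_n -> {set 'I_n} -> {set 'I_n} -> 'S_n) : Prop :=
  forall (i : 'I_n) (L T : {set 'I_n}),
    L \in link D i -> T \in link D i -> #|L| = #|T| ->
    [/\ (sw i L T @: L)%SET = T, (sw i L T @: T)%SET = L & sw i L T i = i].

(* The subgroup pi(D), relative to the choice sw; tperm i i is the identity, so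
   allowing i = j does not change the generated subgroup. *)
Definition switch_group (n : nat) (D : simplicial_complex n)
    (sw : 'I_n -> {set 'I_n} -> {set 'I_n} -> 'S_n) : {set 'S_n} :=
  <<[set s : 'S_n | [exists i : 'I_n, exists L in link D i,
        exists T in link D i, (#|L| == #|T|) && (s == sw i L T)]]
    :|: [set s : 'S_n | [exists i : 'I_n, exists j : 'I_n,
        (link D i :&: link D j != finset.set0) && (s == tperm i j)]]>>%g.

(* Main.v *)
(* A player i can be recovered on its link from the games carrier_hat: on them
   the only nonzero marginal contribution of i is at T itself, so that
   phi i (carrier_hat T) = p i T. The symmetry axiom then transports p along the
   symmetries of D. The switching permutations identify the p i T with T of a
   given size; as the links of any two players that are vertices of D share the
   empty set, the transposition of any such i and j is a symmetry, which
   identifies p i and p j. *)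
Require Import Defs.
From HB Require Import structures.
From mathcomp Require Import all_boot all_order all_algebra all_fingroup.
From mathcomp Require Import all_classical all_reals.

Set Implicit Arguments.
Unset Strict Implicit.
Unset Printing Implicit Defensive.

Import Order.TTheory GRing.Theory Num.Theory.
Local Open Scope ring_scope.

Section LinkCoefficients.
Variables (R : realType) (n : nat) (D : simplicial_complex n).

Lemma mem_Symm_face (s : 'S_n) (S : {set 'I_n}) :
  s \in Symm D -> S \in faces D -> (s @: S)%SET \in faces D.
Proof. by rewrite inE => /forall_inP; apply. Qed.

Lemma mem_Symm_link (s : 'S_n) (i : 'I_n) (T : {set 'I_n}) :
  s \in Symm D -> T \in link D i -> (s @: T)%SET \in link D (s i).
Proof.
move=> sD; rewrite !inE => /and3P[TD iT iTD].
rewrite mem_Symm_face //= mem_imset ?iT //=; last exact: perm_inj.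
by rewrite -imset_set1 -finset.imsetU mem_Symm_face.
Qed.

(** A player with a non-empty link is a vertex, since [i |: T] contains the singleton of [i]. *)
Lemma set0_link (i : 'I_n) (T : {set 'I_n}) :
  T \in link D i -> finset.set0 \in link D i.
Proof.
rewrite !inE => /and3P[TD iT iTD]; rewrite set0_face /=.
by apply: faces_sub iTD _; rewrite finset.setU0 finset.sub1set finset.setU11.
Qed.

(** Adding [i] to [T] gives a face with one more element. *)
Lemma link_card_lt_rank (i : 'I_n) (T : {set 'I_n}) :
  T \in link D i -> (#|T| < rank D)%N.
Proof.
rewrite inE => /and3P[_ iT iTD].
have -> : #|T|.+1 = #|(i |: T)%SET| by rewrite cardsU1 iT.
by rewrite /rank; apply: leq_bigmax_cond.
Qed.

Lemma carrier_hatE (T S : {set 'I_n}) :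
  S \in faces D -> carrier_hat R D T S = (T \proper S)%:R.
Proof. by move=> SD; rewrite /game_eval insubT /= ffunE. Qed.

(** As [s] is injective, it preserves and reflects both inclusion and the comparison of
    cardinalities, hence strict inclusion. *)
Lemma perm_carrier_hat (s : 'S_n) (U : {set 'I_n}) : s \in Symm D ->
  perm_game s (carrier_hat R D (s @: U)%SET) = carrier_hat R D U.
Proof.
move=> sD; apply/val_inj/ffunP => S; rewrite !ffunE.
rewrite carrier_hatE; last by rewrite mem_Symm_face // (valP S).
have sI := @perm_inj _ s.
rewrite !properEcard !card_imset // finset.sub_imset_pre.
have -> : (s @^-1: (s @: val S) = val S)%SET; last by [].
by apply/finset.setP => x; rewrite inE mem_imset.
Qed.

(** Because [i] is not in [T], strict inclusion of [T] in [i |: S] amounts to inclusion in [S];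
    inclusion minus strict inclusion leaves equality. *)
Lemma marginal_carrier_hat (i : 'I_n) (T S : {set 'I_n}) :
  T \in link D i -> S \in link D i ->
  carrier_hat R D T (i |: S)%SET - carrier_hat R D T S = (S == T)%:R.
Proof.
rewrite !inE => /and3P[_ iT _] /and3P[SD iS iSD].
rewrite !carrier_hatE //.
have -> : (T \proper (i |: S)%SET) = (T \subset S).
  rewrite properE finset.subUset finset.sub1set (negbTE iT) /= andbT.
  rewrite -finset.subDset; have /finset.setDidPl -> // : [disjoint T & [set i]%SET].
  by rewrite disjoint_sym disjoints1.
rewrite finset.properEneq eq_sym.
case: eqVneq => [->|_] /=; first by rewrite subxx subr0.
by rewrite subrr.
Qed.

Lemma sum_link_carrier_hat (p : {set 'I_n} -> R) (i : 'I_n) (T : {set 'I_n}) :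
  T \in link D i ->
  \sum_(S in link D i) p S *
    (carrier_hat R D T (i |: S)%SET - carrier_hat R D T S) = p T.
Proof.
move=> Ti; rewrite (bigD1 T) //= marginal_carrier_hat // eqxx mulr1.
rewrite big1 ?addr0 // => S /andP[Si /negbTE ST].
by rewrite marginal_carrier_hat // ST mulr0.
Qed.

Section SymmetricValue.
Variables (I : set (game R D)) (phi : 'I_n -> game R D -> R).
Variable (p : 'I_n -> {set 'I_n} -> R).
Hypothesis I_carrier_hat : forall (i : 'I_n) (T : {set 'I_n}),
  T \in link D i -> I (carrier_hat R D T).
Hypothesis phiE : forall (i : 'I_n) (v : game R D), I v ->
  phi i v = \sum_(T in link D i) p i T * (v (i |: T)%SET - v T).
Hypothesis phi_symm : symmetric_on I phi.

(* With the convention (s . v)(S) = v (s S), the symmetry axiom carries the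
   player i to s i but the coalition s U back to U. *)
Lemma coef_Symm (s : 'S_n) (i : 'I_n) (U : {set 'I_n}) : s \in Symm D ->
  (s @: U)%SET \in link D i -> U \in link D (s i) ->
  p i (s @: U)%SET = p (s i) U.
Proof.
move=> sD sUi Usi; have IsU := I_carrier_hat sUi.
rewrite -(sum_link_carrier_hat (p i) sUi) -phiE // (phi_symm i sD IsU).
rewrite perm_carrier_hat // phiE ?sum_link_carrier_hat //.
exact: I_carrier_hat Usi.
Qed.

Variable sw : 'I_n -> {set 'I_n} -> {set 'I_n} -> 'S_n.
Hypothesis sw_switching : switching D sw.
Hypothesis sw_Symm : switch_group D sw \subset Symm D.

Lemma sw_mem_Symm (i : 'I_n) (L T : {set 'I_n}) :
  L \in link D i -> T \in link D i -> #|L| = #|T| -> sw i L T \in Symm D.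
Proof.
move=> Li Ti LT; apply: (fintype.subsetP sw_Symm); apply: mem_gen.
rewrite finset.in_setU; apply/orP; left; rewrite inE; apply/existsP; exists i.
apply/exists_inP; exists L => //; apply/exists_inP; exists T => //.
by rewrite LT !eqxx.
Qed.

Lemma tperm_mem_Symm (i j : 'I_n) (L T : {set 'I_n}) :
  L \in link D i -> T \in link D j -> tperm i j \in Symm D.
Proof.
move=> Li Tj; apply: (fintype.subsetP sw_Symm); apply: mem_gen.
rewrite finset.in_setU; apply/orP; right; rewrite inE.
apply/existsP; exists i; apply/existsP; exists j; rewrite eqxx andbT.
apply/set0Pn; exists finset.set0.
by rewrite finset.in_setI (set0_link Li) (set0_link Tj).
Qed.

Lemma coef_same_player (i : 'I_n) (L T : {set 'I_n}) :
  L \in link D i -> T \in link D i -> #|L| = #|T| -> p i L = p i T.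
Proof.
move=> Li Ti LT; have [_ sT si] := sw_switching Li Ti LT.
(* [coef_Symm] is used with [U] equal to [T]: the switch sends [T] to [L] and fixes [i]. *)
have := @coef_Symm (sw i L T) i T (sw_mem_Symm Li Ti LT).
by rewrite sT si; apply.
Qed.

Lemma coef_same_card (i j : 'I_n) (L T : {set 'I_n}) :
  L \in link D i -> T \in link D j -> #|L| = #|T| -> p i L = p j T.
Proof.
move=> Li Tj LT; have sD := tperm_mem_Symm Li Tj.
(* The image of [T] under the transposition lies in the link of [i] and has the size of [L]. It
   links the two moves: first change the coalition for player [i], then pass from [i] to [j]. *)
have := mem_Symm_link sD Tj; rewrite tpermR => sTi.
have cardsT : #|(tperm i j @: T)%SET| = #|T|.
  by rewrite card_imset //; exact: perm_inj.
by rewrite (coef_same_player Li sTi) ?cardsT // coef_Symm ?tpermL.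
Qed.

End SymmetricValue.
End LinkCoefficients.

Theorem theorem5p3 (R : realType) (n : nat) (D : simplicial_complex n)
    (I : set (game R D))
    (phi : 'I_n -> game R D -> R)
    (p : 'I_n -> {set 'I_n} -> R)
    (sw : 'I_n -> {set 'I_n} -> {set 'I_n} -> 'S_n)
    (I_cone : is_cone I)
    (I_carrier : forall (i : 'I_n) (T : {set 'I_n}) (T0 : T != finset.set0),
      T \in link D i -> I (carrier R D T0))
    (I_carrier_hat : forall (i : 'I_n) (T : {set 'I_n}),
      T \in link D i -> I (carrier_hat R D T))
    (I_perm : forall (s : 'S_n) (v : game R D),
      s \in Symm D -> I v -> I (perm_game s v))
    (phiE : forall (i : 'I_n) (v : game R D), I v ->
      phi i v = \sum_(T in link D i) p i T * (v (i |: T)%SET - v T))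
    (sw_switching : switching D sw)
    (sw_Symm : switch_group D sw \subset Symm D)
    (phi_symm : symmetric_on I phi) :
  exists q : nat -> R, forall (i : 'I_n) (T : {set 'I_n}),
    T \in link D i -> T != finset.set0 ->
    (1 <= #|T| <= rank D - 1)%N /\ p i T = q #|T|.
Proof.
(* [q t] is the coefficient of an arbitrary player and link face of size [t], or 0 if there is none;
   by [coef_same_card] the choice does not matter. *)
pose q t :=
  if [pick x : 'I_n * {set 'I_n} | (x.2 \in link D x.1) && (#|x.2| == t)]
  is Some x then p x.1 x.2 else 0.
exists q => i T Ti T0; split.
  have Trank := link_card_lt_rank Ti.
  (* [Trank] also makes the rank positive, so the subtraction is not truncated. *)
  by rewrite card_gt0 T0 /= leq_subRL ?add1n // (leq_ltn_trans _ Trank).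
(* The default case cannot occur: [(i, T)] itself is a candidate. *)
rewrite /q; case: pickP => [[j L] /= /andP[Lj /eqP LT]|/(_ (i, T))]; last first.
  by rewrite /= Ti eqxx.
exact: (coef_same_card I_carrier_hat phiE phi_symm sw_switching sw_Symm).
Qed.
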